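(* Let $\mathcal{M}=\{A,B,C,D,E\}$ be a minimal model, considered either in the continuous-time (CT) case or in the discrete-time (DT) case, and let $X\in\mathbb{X}^{\gg}$ be a certificate for the corresponding strict linear matrix inequality. Put $c^2:=\lambda_{\min}(X)$ with $c>0$, let $T\in\mathbb{C}^{n\times n}$ satisfy $X=c^2T^{\mathsf H}T$, and let $$\mathcal{M}_T:=\{TAT^{\mathsf H},\,TB,\,CT^{\mathsf H},\,D,\,TET^{\mathsf H}\}.$$ Then, in both the CT case and the DT case, the normalized $X$-passivity radius of $\mathcal{M}_T$ is at least as large as the $X$-passivity radius of $\mathcal{M}$: $$\rho_{\mathcal{M}_T}(c^2I_n)\ \ge\ \rho_{\mathcal{M}}(X).$$
   Context: A model is a quintuple $\mathcal{M}=\{A,B,C,D,E\}$ with $A,E\in\mathbb{C}^{n\times n}$, $B\in\mathbb{C}^{n\times m}$, $C\in\mathbb{C}^{m\times n}$, $D\in\mathbb{C}^{m\times m}$ ($n,m\ge 1$). It is minimal if for all $\lambda\in\mathbb{C}$ one has $\operatorname{rank}[\lambda E-A\mid B]=n$ and $\operatorname{rank}[\lambda E^{\mathsf H}-A^{\mathsf H}\mid C^{\mathsf H}]=n$. $V^{\mathsf H}$ is the conjugate transpose, $\mathbb{H}_n$ the real vector space of Hermitian $n\times n$ matrices, $M\succ0$ ($M\succeq 0$) means positive (semi)definite, and $\lambda_{\min}(X)$ is the smallest eigenvalue of $X\in\mathbb{H}_n$. For $X\in\mathbb{H}_n$, the matrix $W(X,\mathcal{M})$ denotes, in the CT case, $$W_c(X,\mathcal{M})=\begin{bmatrix}-A^{\mathsf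 H}XE-E^{\mathsf H}XA & C^{\mathsf H}-E^{\mathsf H}XB\\ C-B^{\mathsf H}XE & D^{\mathsf H}+D\end{bmatrix},$$ and, in the DT case, $$\widehat W_d(X,\mathcal{M})=\begin{bmatrix}X & XA & XB\\ A^{\mathsf H}X & E^{\mathsf H}XE & C^{\mathsf H}\\ B^{\mathsf H}X & C & D^{\mathsf H}+D\end{bmatrix}.$$ The set of strict certificates is $\mathbb{X}^{\gg}:=\{X\in\mathbb{H}_n: X\succ0,\ W(X,\mathcal{M})\succ0\}$. (In the DT case, for $X\succ0$, $\widehat W_d(X,\mathcal{M})\succ0$ is equivalent to positive definiteness of its Schur complement $$W_d(X,\mathcal{M})=\begin{bmatrix}E^{\mathsf H}XE-A^{\mathsf H}XA & C^{\mathsf H}-A^{\mathsf H}XB\\ C-B^{\mathsf H}XA & D^{\mathsf H}+D-B^{\mathsf H}XB\end{bmatrix}.)$$ A perturbation is $\Delta_{\mathcal M}=\{\Delta_A,\Delta_B,\Delta_C,\Delta_D,0\}$ ($E$ is not perturbed), with $\mathcal{M}+\Delta_{\mathcal M}=\{A+\Delta_A,B+\Delta_B,C+\Delta_C,D+\Delta_D,E\}$. It is identified with $\Delta=\begin{bmatrix}\Delta_A&\Delta_B\\ \Delta_C&\Delta_D\end{bmatrix}\in\mathbb{C}^{(n+m)\times(n+m)}$, and its size $\|\Delta_{\mathcal M}\|$ is $\|\Delta\|$, where $\|\cdot\|$ is either the spectral norm or the Frobenius norm (the same choice throughout). For $X\in\mathbb{X}^{\gg}$ the $X$-passivity radius of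 $\mathcal{M}$ is $$\rho_{\mathcal M}(X):=\inf_{\Delta_{\mathcal M}}\{\|\Delta_{\mathcal M}\| : \det W(X,\mathcal{M}+\Delta_{\mathcal M})=0\}.$$ The number $\rho_{\mathcal{M}_T}(c^2I_n)$ is defined in the same way, with model $\mathcal{M}_T$ and certificate $c^2I_n$. *)

(* Defs.v *)
From mathcomp Require Import all_boot all_order all_algebra.
From mathcomp Require Import spectral complex.
From mathcomp Require Import boolp classical_sets reals ereal constructive_ereal.

Set Implicit Arguments.
Unset Strict Implicit.
Unset Printing Implicit Defensive.

Import Order.TTheory GRing.Theory Num.Theory.

Local Open Scope ring_scope.
Local Open Scope sesquilinear_scope.
Local Open Scope complex_scope.
Local Open Scope classical_set_scope.

(* [A ^t*] is the conjugate transpose and [hermsymmx] the set of Hermitian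
   matrices. On R[i], [0 < z] means that z is real and positive. *)
Definition posdef (R : realType) (n : nat) (M : 'M[R[i]]_n) : Prop :=
  M \is hermsymmx /\
  forall v : 'cV[R[i]]_n, v != 0 -> 0 < (v ^t* *m M *m v) 0 0.

(* [l] is the smallest eigenvalue of X. Only meant for Hermitian X, whose
   eigenvalues are all real. *)
Definition is_lambda_min (R : realType) (n : nat) (X : 'M[R[i]]_n) (l : R) :
    Prop :=
  eigenvalue X l%:C /\ forall mu : R, eigenvalue X mu%:C -> l <= mu.

Definition frobenius_norm (R : realType) (m n : nat) (A : 'M[R[i]]_(m, n)) : R :=
  Num.sqrt (\sum_i \sum_j Normc.normc (A i j) ^+ 2).

(* The operator norm induced by the Euclidean norm; the latter is the Frobenius
   norm on column vectors. *)
Definition spectral_norm (R : realType) (m n : nat) (A : 'M[R[i]]_(m, n)) : R :=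
  sup [set frobenius_norm (A *m v) |
       v in [set v : 'cV[R[i]]_n | frobenius_norm v = 1]].

Inductive norm_kind := Spectral | Frobenius.

Definition mxnorm (R : realType) (nk : norm_kind) (m n : nat)
    (A : 'M[R[i]]_(m, n)) : R :=
  match nk with
  | Spectral => spectral_norm A
  | Frobenius => frobenius_norm A
  end.

Record model (R : realType) (n m : nat) := Model {
  mA : 'M[R[i]]_n;
  mB : 'M[R[i]]_(n, m);
  mC : 'M[R[i]]_(m, n);
  mD : 'M[R[i]]_m;
  mE : 'M[R[i]]_n }.

Definition minimal (R : realType) (n m : nat) (M : model R n m) : Prop :=
  forall lambda : R[i],
    \rank (row_mx (lambda *: mE M - mA M) (mB M)) = n /\
    \rank (row_mx (lambda *: (mE M) ^t* - (mA M) ^t* ) ((mC M) ^t* )) = n.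

Inductive time_domain := CT | DT.

Definition W_c (R : realType) (n m : nat) (X : 'M[R[i]]_n) (M : model R n m) :
    'M[R[i]]_(n + m) :=
  let: Model A B C D E := M in
  block_mx (- (A ^t* *m X *m E) - E ^t* *m X *m A) (C ^t* - E ^t* *m X *m B)
           (C - B ^t* *m X *m E)                   (D ^t* + D).

Definition What_d (R : realType) (n m : nat) (X : 'M[R[i]]_n)
    (M : model R n m) : 'M[R[i]]_(n + (n + m)) :=
  let: Model A B C D E := M in
  block_mx X                                    (row_mx (X *m A) (X *m B))
           (col_mx (A ^t* *m X) (B ^t* *m X))
           (block_mx (E ^t* *m X *m E) (C ^t* )
                     C                 (D ^t* + D)).

Definition W_dim (t : time_domain) (n m : nat) : nat :=
  match t with CT => (n + m)%N | DT => (n + (n + m))%N end.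

Definition W (R : realType) (t : time_domain) (n m : nat) (X : 'M[R[i]]_n)
    (M : model R n m) : 'M[R[i]]_(W_dim t n m) :=
  match t return 'M[R[i]]_(W_dim t n m) with
  | CT => W_c X M
  | DT => What_d X M
  end.

Definition strict_certificates (R : realType) (t : time_domain) (n m : nat)
    (M : model R n m) : set 'M[R[i]]_n :=
  [set X | [/\ X \is hermsymmx, posdef X & posdef (W t X M)]].

(* The blocks of Delta are Delta_A, Delta_B, Delta_C and Delta_D; E is not
   perturbed. *)
Definition perturb (R : realType) (n m : nat) (M : model R n m)
    (Delta : 'M[R[i]]_(n + m)) : model R n m :=
  let: Model A B C D E := M in
  Model (A + ulsubmx Delta) (B + ursubmx Delta)
        (C + dlsubmx Delta) (D + drsubmx Delta) E.

(* Extended-real valued, so that the infimum of the empty set is +oo. *)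
Definition passivity_radius (R : realType) (nk : norm_kind) (t : time_domain)
    (n m : nat) (M : model R n m) (X : 'M[R[i]]_n) : \bar R :=
  ereal_inf [set (mxnorm nk Delta)%:E |
             Delta in [set Delta | \det (W t X (perturb M Delta)) = 0]].

Definition transform (R : realType) (n m : nat) (T : 'M[R[i]]_n)
    (M : model R n m) : model R n m :=
  let: Model A B C D E := M in
  Model (T *m A *m T ^t* ) (T *m B) (C *m T ^t* ) D (T *m E *m T ^t* ).

(* Main.v *)
Require Import Defs.
From mathcomp Require Import all_boot all_order all_algebra.
From mathcomp Require Import spectral complex.
From mathcomp Require Import boolp classical_sets reals ereal constructive_ereal.

Set Implicit Arguments.
Unset Strict Implicit.
Unset Printing Implicit Defensive.

Import Order.TTheory GRing.Theory Num.Theory.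

Local Open Scope ring_scope.
Local Open Scope sesquilinear_scope.
Local Open Scope complex_scope.
Local Open Scope classical_set_scope.

(** As X = c^2 T^H T is definite, T is invertible. Since c^2 is the smallest
    eigenvalue of X, the spectral theorem gives |T v| >= |v| for all v, so that
    T^-1 is a contraction ([contraction_invmx_factor]).

    Put G = diag(T, I). The linear matrix inequality of the transformed model
    at c^2 I is congruent to that of M at X: only the value c^2 T^H T = X ever
    enters, and the outer factors T and T^H pull out of the blocks
    ([continuous_lmi_congruence], [discrete_lmi_congruence]). Perturbing the
    transformed model by G Delta G^H amounts to transforming the model
    perturbed by Delta ([perturb_transform]).

    Hence, for each Delta_T that makes the transformed inequality singular, the
    perturbation Delta = G^-1 Delta_T G^-H makes the original one singular. As
    G^-1 = diag(T^-1, I) is a contraction, and the adjoint of a contraction is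
    a contraction ([contraction_adj]), the norm of Delta, spectral or
    Frobenius, is at most that of Delta_T ([mxnorm_contraction]). Comparing
    infima concludes. *)

(** * Contractions *)

Section Contractions.
Variable C : numClosedFieldType.

Lemma adjmxM (m n p : nat) (A : 'M[C]_(m, n)) (B : 'M[C]_(n, p)) :
  (A *m B) ^t* = B ^t* *m A ^t*.
Proof. by rewrite trmx_mul map_mxM. Qed.

(** The squared Frobenius norm, with values in the closed field itself so that
    it is linear algebra over that field. *)
Definition sqnorm (m n : nat) (A : 'M[C]_(m, n)) : C := \tr (A ^t* *m A).

Lemma sqnormE (m n : nat) (A : 'M[C]_(m, n)) :
  sqnorm A = \sum_i \sum_j `|A i j| ^+ 2.
Proof.
rewrite /sqnorm /mxtrace exchange_big; apply: eq_bigr => j _.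
by rewrite mxE; apply: eq_bigr => i _; rewrite !mxE normCKC.
Qed.

Lemma sqnorm_ge0 (m n : nat) (A : 'M[C]_(m, n)) : 0 <= sqnorm A.
Proof.
rewrite sqnormE; apply: sumr_ge0 => i _; apply: sumr_ge0 => j _.
by rewrite exprn_ge0.
Qed.

Lemma sqnorm_eq0 (m n : nat) (A : 'M[C]_(m, n)) : sqnorm A = 0 -> A = 0.
Proof.
rewrite sqnormE => A0; apply/matrixP => i j; rewrite mxE.
have sq_ge0 k l : 0 <= `|A k l| ^+ 2 by rewrite exprn_ge0.
have /psumr_eq0P/(_ i isT) := A0.
move=> /(_ (fun k _ => sumr_ge0 _ (fun l _ => sq_ge0 k l))).
move=> /(psumr_eq0P (fun l _ => sq_ge0 i l))/(_ j isT)/eqP.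
by rewrite expf_eq0 normr_eq0 => /eqP.
Qed.

Lemma sqnorm_adj (m n : nat) (A : 'M[C]_(m, n)) : sqnorm (A ^t*) = sqnorm A.
Proof. by rewrite /sqnorm trmxCK mxtrace_mulC. Qed.

Lemma sqnorm_col (m n : nat) (A : 'M[C]_(m, n)) :
  sqnorm A = \sum_j sqnorm (col j A).
Proof.
rewrite sqnormE exchange_big; apply: eq_bigr => j _; rewrite sqnormE.
by apply: eq_bigr => i _; rewrite big_ord1 mxE.
Qed.

Lemma sqnorm_col_mx (m1 m2 n : nat) (A : 'M[C]_(m1, n)) (B : 'M[C]_(m2, n)) :
  sqnorm (col_mx A B) = sqnorm A + sqnorm B.
Proof. by rewrite /sqnorm tr_col_mx map_row_mx mul_row_col mxtraceD. Qed.

Definition contraction (m n : nat) (S : 'M[C]_(m, n)) : Prop :=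
  forall v : 'cV[C]_n, sqnorm (S *m v) <= sqnorm v.

Lemma contraction_mulmxl (m n k : nat) (S : 'M[C]_(m, n)) (A : 'M[C]_(n, k)) :
  contraction S -> sqnorm (S *m A) <= sqnorm A.
Proof.
move=> S_contr; rewrite [sqnorm A]sqnorm_col sqnorm_col.
by apply: ler_sum => j _; rewrite !colE -mulmxA.
Qed.

(** With w = S^H v, both cross terms of |S w - v|^2 are equal to |w|^2, so
    0 <= |S w - v|^2 = |S w|^2 + |v|^2 - 2 |w|^2, where |S w| <= |w|. *)
Lemma contraction_adj (m n : nat) (S : 'M[C]_(m, n)) :
  contraction S -> contraction (S ^t*).
Proof.
move=> S_contr v; set w := S ^t* *m v.
have := sqnorm_ge0 (S *m w - v).
have -> : sqnorm (S *m w - v) = sqnorm (S *m w) + sqnorm v - sqnorm w *+ 2.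
  have adjB : (S *m w - v) ^t* = (S *m w) ^t* - v ^t*.
    by rewrite -map_mxB; congr (_ ^ _); rewrite linearB.
  have trB k (U V : 'M[C]_k) : \tr (U - V) = \tr U - \tr V by rewrite linearB.
  rewrite /sqnorm adjB mulmxBl !mulmxBr !trB.
  have -> : (S *m w) ^t* *m v = w ^t* *m w by rewrite adjmxM -mulmxA.
  have -> : v ^t* *m (S *m w) = w ^t* *m w.
    by rewrite {3}/w adjmxM trmxCK mulmxA.
  by rewrite opprB mulr2n opprD addrACA.
rewrite subr_ge0 => /le_trans/(_ (lerD (S_contr w) (lexx _))).
by rewrite mulr2n lerD2l.
Qed.

Lemma contraction_mulmxr (m n k : nat) (S : 'M[C]_(m, n)) (A : 'M[C]_(k, m)) :
  contraction (S ^t*) -> sqnorm (A *m S) <= sqnorm A.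
Proof.
move=> S_contr; rewrite -sqnorm_adj adjmxM -(sqnorm_adj A).
exact: contraction_mulmxl.
Qed.

(** A unit vector is an isometric embedding of the line. Passing to its adjoint
    yields |A v| <= |A| for the Frobenius norm of A, without Cauchy-Schwarz. *)
Lemma contraction_unit_cV (n : nat) (v : 'cV[C]_n) :
  sqnorm v = 1 -> contraction v.
Proof.
move=> v1 x; rewrite /sqnorm adjmxM -mulmxA (mulmxA _ v).
by rewrite [v ^t* *m v]mx11_scalar -trace_mx11 -/(sqnorm v) v1 mul1mx.
Qed.

(** The Rayleigh bound: in an orthonormal eigenbasis the form is a weighted sum
    of squared moduli whose weights are eigenvalues. *)
Lemma hermitian_form_ge (n : nat) (A : 'M[C]_n) (l : C) :
    A \is hermsymmx ->
    (forall mu, mu \is Num.real -> eigenvalue A mu -> l <= mu) ->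
  forall v : 'cV[C]_n, l * sqnorm v <= \tr (v ^t* *m A *m v).
Proof.
move=> A_herm l_le v.
set P := spectralmx A; set d := spectral_diag A.
have A_eq : A = invmx P *m diag_mx d *m P.
  by apply/orthomx_spectralP; exact: hermitian_normalmx.
have P_unitary : P \is unitarymx := spectral_unitarymx A.
have P_unit : P \in unitmx := spectral_unit A.
have d_ge i : l <= d 0 i.
  apply: l_le.
    by have /mxOverP := hermitian_spectral_diag_real A_herm; apply.
  apply/eigenvalueP; exists (row i P).
    rewrite [X in _ *m X]A_eq -row_mul !mulmxA mulmxV // mul1mx row_mul.
    rewrite row_diag_mx -scalemxAl; congr (_ *: _).
    by rewrite -rowE.
  (* A row of an invertible matrix is nonzero, hence an eigenvector. *)
  apply/eqP => Pi0; have : row i (1%:M : 'M[C]_n) = 0.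
    by rewrite -(mulmxV P_unit) row_mul Pi0 mul0mx.
  move=> /matrixP/(_ 0 i); rewrite !mxE eqxx => /eqP.
  by rewrite oner_eq0.
set w := P *m v.
have -> : sqnorm v = sqnorm w.
  rewrite /sqnorm adjmxM -mulmxA (mulmxA _ P) -invmx_unitary //.
  by rewrite mulVmx // mul1mx.
have -> : v ^t* *m A *m v = w ^t* *m (diag_mx d *m w).
  by rewrite [X in _ *m X *m _]A_eq invmx_unitary // adjmxM !mulmxA.
rewrite sqnormE mulr_sumr /mxtrace big_ord1 mxE.
move: (w) => u; apply: ler_sum => i _.
rewrite big_ord1 mul_diag_mx !mxE [leRHS]mulrCA -normCKC.
by apply: ler_wpM2r; rewrite ?exprn_ge0.
Qed.

(** The Rayleigh bound for X reads a |w|^2 <= a |T w|^2; take w = T^-1 v. *)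
Lemma contraction_invmx_factor (n : nat) (X T : 'M[C]_n) (a : C) :
    X \is hermsymmx -> T \in unitmx -> 0 < a ->
    (forall mu, mu \is Num.real -> eigenvalue X mu -> a <= mu) ->
    X = a *: (T ^t* *m T) ->
  contraction (invmx T).
Proof.
move=> X_herm T_unit a_gt0 a_le X_eq v.
rewrite -[in leRHS](mulKVmx T_unit v); move: (invmx T *m v) => w.
have := hermitian_form_ge X_herm a_le w.
rewrite X_eq -scalemxAr -scalemxAl mxtraceZ ler_pM2l //.
by rewrite [sqnorm (T *m w)]/sqnorm adjmxM !mulmxA.
Qed.

End Contractions.

(** * The Frobenius and spectral norms *)

Section Norms.
Variable R : realType.
Local Notation C := R[i].

Lemma frobenius_norm_ge0 (m n : nat) (A : 'M[C]_(m, n)) : 0 <= frobenius_norm A.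
Proof. exact: sqrtr_ge0. Qed.

Lemma sqr_frobenius_norm (m n : nat) (A : 'M[C]_(m, n)) :
  (frobenius_norm A ^+ 2)%:C = sqnorm A.
Proof.
rewrite /frobenius_norm sqr_sqrtr; last first.
  by apply: sumr_ge0 => i _; apply: sumr_ge0 => j _; rewrite sqr_ge0.
rewrite sqnormE rmorph_sum; apply: eq_bigr => i _.
by rewrite rmorph_sum; apply: eq_bigr => j _; rewrite rmorphXn.
Qed.

Lemma ler_frobenius_norm (m n p q : nat) (A : 'M[C]_(m, n)) (B : 'M[C]_(p, q)) :
  (frobenius_norm A <= frobenius_norm B) = (sqnorm A <= sqnorm B).
Proof.
rewrite -!sqr_frobenius_norm lecR ler_sqr //; exact: frobenius_norm_ge0.
Qed.

Lemma sqnorm_frobenius_norm1 (m n : nat) (A : 'M[C]_(m, n)) :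
  frobenius_norm A = 1 -> sqnorm A = 1.
Proof. by move=> A1; rewrite -sqr_frobenius_norm A1 expr1n. Qed.

Lemma frobenius_normZ (m n : nat) (a : R) (A : 'M[C]_(m, n)) :
  0 <= a -> frobenius_norm (a%:C *: A) = a * frobenius_norm A.
Proof.
move=> a0; have aF0 := mulr_ge0 a0 (frobenius_norm_ge0 A).
apply/eqP; rewrite -(eqrXn2 (n := 2)) ?frobenius_norm_ge0 //; apply/eqP.
apply: (@complexI R); rewrite sqr_frobenius_norm exprMn rmorphM /=.
rewrite sqr_frobenius_norm !sqnormE mulr_sumr; apply: eq_bigr => i _.
rewrite mulr_sumr; apply: eq_bigr => j _; rewrite mxE normrM exprMn.
by rewrite [`|a%:C|]ger0_norm ?lecR // rmorphXn.
Qed.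

Lemma frobenius_norm0 (m n : nat) : frobenius_norm (0 : 'M[C]_(m, n)) = 0.
Proof.
rewrite /frobenius_norm big1 ?sqrtr0 // => i _; rewrite big1 // => j _.
by rewrite mxE Normc.normc0 expr0n.
Qed.

Lemma frobenius_norm_eq0 (m n : nat) (A : 'M[C]_(m, n)) :
  frobenius_norm A = 0 -> A = 0.
Proof.
by move=> A0; apply: sqnorm_eq0; rewrite -sqr_frobenius_norm A0 expr0n.
Qed.

(** The supremum in the spectral norm is only meaningful once the set is known
    to be bounded; the Frobenius norm of A is a bound. *)
Lemma spectral_norm_ubound (m n : nat) (A : 'M[C]_(m, n)) :
  has_ubound [set frobenius_norm (A *m v) |
              v in [set v : 'cV[C]_n | frobenius_norm v = 1]].
Proof.
exists (frobenius_norm A) => _ [v /= v1 <-]; rewrite ler_frobenius_norm.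
apply: contraction_mulmxr; apply: contraction_adj; apply: contraction_unit_cV.
exact: sqnorm_frobenius_norm1.
Qed.

Lemma frobenius_norm_mul_cV (m n : nat) (A : 'M[C]_(m, n)) (v : 'cV[C]_n) :
  frobenius_norm (A *m v) <= spectral_norm A * frobenius_norm v.
Proof.
have [v0|v_neq0] := eqVneq (frobenius_norm v) 0.
  by rewrite v0 mulr0 (frobenius_norm_eq0 v0) mulmx0 frobenius_norm0.
have v_gt0 : 0 < frobenius_norm v by rewrite lt_def v_neq0 frobenius_norm_ge0.
have iv_ge0 : 0 <= (frobenius_norm v)^-1 by rewrite invr_ge0 ltW.
rewrite -ler_pdivrMr // mulrC -frobenius_normZ // scalemxAr.
apply: (ub_le_sup (spectral_norm_ubound A)) => /=.
by eexists; last reflexivity; rewrite /= frobenius_normZ // mulVf.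
Qed.

Lemma exists_unit_cV (n : nat) :
  (0 < n)%N -> exists v : 'cV[C]_n, frobenius_norm v = 1.
Proof.
case: n => // n _; exists (delta_mx 0 0).
apply/eqP; rewrite -(eqrXn2 (n := 2)) ?frobenius_norm_ge0 //; apply/eqP.
apply: (@complexI R); rewrite sqr_frobenius_norm expr1n /sqnorm.
by rewrite trmx_delta map_delta_mx mul_delta_mx trace_mx11 mxE.
Qed.

Lemma spectral_norm_ge0 (m n : nat) (A : 'M[C]_(m, n)) :
  (0 < n)%N -> 0 <= spectral_norm A.
Proof.
move=> /exists_unit_cV[u u1]; rewrite -[spectral_norm A]mulr1 -u1.
exact: le_trans (frobenius_norm_ge0 _) (frobenius_norm_mul_cV A u).
Qed.

(** Each factor can be removed in turn. For the Frobenius norm, S on the left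
    shrinks the columns and S^H on the right the rows; for the spectral norm, S
    shrinks the values of D and S^H the vectors fed to it. *)
Lemma mxnorm_contraction (nk : norm_kind) (n : nat) (S D : 'M[C]_n) :
    (0 < n)%N -> contraction S ->
  mxnorm nk (S *m D *m S ^t*) <= mxnorm nk D.
Proof.
move=> n_gt0 S_contr; have Sadj_contr := contraction_adj S_contr.
case: nk => /=; last first.
  rewrite ler_frobenius_norm -mulmxA.
  apply: le_trans (contraction_mulmxl _ S_contr) _.
  by apply: contraction_mulmxr; rewrite trmxCK.
have [u u1] := exists_unit_cV n_gt0; apply: ge_sup; first by eexists; exists u.
move=> _ [v /= v1 <-]; rewrite -!mulmxA.
apply: (@le_trans _ _ (frobenius_norm (D *m (S ^t* *m v)))).
  by rewrite ler_frobenius_norm.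
apply: le_trans (frobenius_norm_mul_cV _ _) _.
apply: ler_piMr; first exact: spectral_norm_ge0.
by rewrite -v1 ler_frobenius_norm.
Qed.

End Norms.

(** * Congruence of the matrix inequalities *)

Section PadIdentity.
Variables (C : numClosedFieldType) (n k : nat).

Definition pad_mx (T : 'M[C]_n) : 'M[C]_(n + k) := block_mx T 0 0 1%:M.

Lemma adj_pad_mx T : (pad_mx T) ^t* = pad_mx (T ^t*).
Proof.
by rewrite /pad_mx tr_block_mx map_block_mx !trmx0 trmx1 !map_mx0 map_mx1.
Qed.

Lemma mul_pad_block_pad (U V : 'M[C]_n) A B G D :
  pad_mx U *m block_mx A B G D *m pad_mx V
  = block_mx (U *m A *m V) (U *m B) (G *m V) D.
Proof.
rewrite /pad_mx mulmx_block !(mul0mx, addr0, add0r, mul1mx).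
by rewrite mulmx_block !(mulmx0, addr0, add0r, mulmx1).
Qed.

Lemma pad_mxM T1 T2 : pad_mx T1 *m pad_mx T2 = pad_mx (T1 *m T2).
Proof.
by rewrite /pad_mx mulmx_block !(mul0mx, mulmx0, addr0, add0r, mul1mx).
Qed.

Lemma pad_mx1 : pad_mx 1%:M = 1%:M.
Proof. by rewrite /pad_mx -scalar_mx_block. Qed.

Lemma det_pad_mx T : \det (pad_mx T) = \det T.
Proof. by rewrite det_ublock det1 mulr1. Qed.

Lemma contraction_pad_mx T : contraction T -> contraction (pad_mx T).
Proof.
move=> T_contr v; rewrite -[v]vsubmxK mul_block_col !mul0mx addr0 add0r mul1mx.
by rewrite !sqnorm_col_mx lerD2r.
Qed.

Lemma mul_row_pad p (A : 'M[C]_(p, n)) (B : 'M[C]_(p, k)) V :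
  row_mx A B *m pad_mx V = row_mx (A *m V) B.
Proof. by rewrite mul_row_block !(mulmx0, addr0, add0r, mulmx1). Qed.

Lemma mul_pad_col p (A : 'M[C]_(n, p)) (B : 'M[C]_(k, p)) U :
  pad_mx U *m col_mx A B = col_mx (U *m A) B.
Proof. by rewrite mul_block_col !(mul0mx, addr0, add0r, mul1mx). Qed.

Definition prepad_mx (G : 'M[C]_k) : 'M[C]_(n + k) := block_mx 1%:M 0 0 G.

Lemma det_prepad_mx G : \det (prepad_mx G) = \det G.
Proof. by rewrite det_ublock det1 mul1r. Qed.

Lemma mul_prepad_block_prepad (U V : 'M[C]_k) A B G D :
  prepad_mx U *m block_mx A B G D *m prepad_mx V
  = block_mx A (B *m V) (U *m G) (U *m D *m V).
Proof.
rewrite /prepad_mx mulmx_block !(mul0mx, addr0, add0r, mul1mx).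
by rewrite mulmx_block !(mulmx0, addr0, add0r, mulmx1).
Qed.

End PadIdentity.

(** Stated on explicit blocks over an abstract field: there the identities are
    just associativity, since Y only occurs in products T^H Y T. *)
Section Congruence.
Variables (C : numClosedFieldType) (n k : nat).
Variables (A E T X Y : 'M[C]_n) (B : 'M[C]_(n, k)) (G : 'M[C]_(k, n)).
Variable D : 'M[C]_k.
Hypothesis X_eq : X = T ^t* *m Y *m T.
Local Notation A_T := (T *m A *m T ^t*).
Local Notation E_T := (T *m E *m T ^t*).
Local Notation B_T := (T *m B).
Local Notation G_T := (G *m T ^t*).

Lemma continuous_lmi_congruence :
  block_mx (- (A_T ^t* *m Y *m E_T) - E_T ^t* *m Y *m A_T)
           (G_T ^t* - E_T ^t* *m Y *m B_T)
           (G_T - B_T ^t* *m Y *m E_T) D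
  = pad_mx k T
    *m block_mx (- (A ^t* *m X *m E) - E ^t* *m X *m A)
                (G ^t* - E ^t* *m X *m B)
                (G - B ^t* *m X *m E) D
    *m (pad_mx k T) ^t*.
Proof.
rewrite adj_pad_mx mul_pad_block_pad X_eq !adjmxM !trmxCK.
by rewrite !(mulmxBl, mulmxBr, mulmxN, mulNmx) !mulmxA.
Qed.

(** Both sides are products, so that no inverse of T appears: in terms of T^-1,
    the congruence factor would be diag(T^-H, T, I). *)
Lemma discrete_lmi_congruence :
  pad_mx (n + k) (T ^t*)
    *m block_mx Y (row_mx (Y *m A_T) (Y *m B_T))
                (col_mx (A_T ^t* *m Y) (B_T ^t* *m Y))
                (block_mx (E_T ^t* *m Y *m E_T) (G_T ^t*) G_T D)
    *m pad_mx (n + k) T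
  = prepad_mx n (pad_mx k T)
    *m block_mx X (row_mx (X *m A) (X *m B))
                (col_mx (A ^t* *m X) (B ^t* *m X))
                (block_mx (E ^t* *m X *m E) (G ^t*) G D)
    *m prepad_mx n ((pad_mx k T) ^t*).
Proof.
rewrite adj_pad_mx mul_pad_block_pad mul_prepad_block_prepad.
rewrite mul_pad_block_pad mul_row_pad mul_pad_col mul_mx_row mul_col_mx.
by rewrite X_eq !adjmxM !trmxCK !mulmxA.
Qed.

End Congruence.

(** * Transforming a model *)

Section Transform.
Variables (R : realType) (n m : nat).
Local Notation C := R[i].
Implicit Types (T X Y : 'M[C]_n) (M : model R n m).

Lemma perturb_transform T M (D : 'M[C]_(n + m)) :
  perturb (transform T M) (pad_mx m T *m D *m (pad_mx m T) ^t*)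
  = transform T (perturb M D).
Proof.
case: M => A B G D0 E /=; rewrite adj_pad_mx -[D in LHS]submxK.
rewrite mul_pad_block_pad block_mxKul block_mxKur block_mxKdl block_mxKdr.
by rewrite !mulmxDr !mulmxDl.
Qed.

Lemma W_c_transform T X Y M : X = T ^t* *m Y *m T ->
  W_c Y (transform T M) = pad_mx m T *m W_c X M *m (pad_mx m T) ^t*.
Proof. by case: M => A B G D E; apply: continuous_lmi_congruence. Qed.

Lemma What_d_transform T X Y M : X = T ^t* *m Y *m T ->
  pad_mx (n + m) (T ^t*) *m What_d Y (transform T M) *m pad_mx (n + m) T
  = prepad_mx n (pad_mx m T) *m What_d X M *m prepad_mx n ((pad_mx m T) ^t*).
Proof. by case: M => A B G D E; apply: discrete_lmi_congruence. Qed.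

(** The congruence factors are invertible because T is. *)
Lemma det_W_transform (t : time_domain) T X Y M :
    T \in unitmx -> X = T ^t* *m Y *m T ->
    \det (W t Y (transform T M)) = 0 ->
  \det (W t X M) = 0.
Proof.
rewrite unitmxE unitfE => T_neq0 X_eq detW_T.
have adjT_neq0 : \det (T ^t*) != 0 by rewrite det_map_mx det_tr conjC_eq0.
case: t detW_T => /= [|/(congr1 (fun d => \det (T ^t*) * d * \det T))].
  rewrite (W_c_transform _ X_eq) !det_mulmx adj_pad_mx !det_pad_mx => /eqP.
  by rewrite !mulf_eq0 (negPf T_neq0) (negPf adjT_neq0) orbF => /eqP.
rewrite mulr0 mul0r -(det_pad_mx (n + m) T) -(det_pad_mx (n + m) (T ^t*)).
rewrite -!det_mulmx (What_d_transform _ X_eq) !det_mulmx adj_pad_mx.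
rewrite !det_prepad_mx !det_pad_mx => /eqP.
by rewrite !mulf_eq0 (negPf T_neq0) (negPf adjT_neq0) orbF => /eqP.
Qed.

End Transform.

(** A kernel vector of T would be isotropic for X. *)
Lemma posdef_factor_unit (R : realType) (n : nat) (X T : 'M[R[i]]_n)
    (a : R[i]) :
  posdef X -> X = a *: (T ^t* *m T) -> T \in unitmx.
Proof.
move=> [_ X_pos] X_eq; rewrite -unitmx_tr unitmxE unitfE.
apply/negP => /det0P[u u_neq0 uT0].
have Tu0 : T *m u^T = 0 by rewrite -[T]trmxK -trmx_mul uT0 trmx0.
have := X_pos u^T; rewrite trmx_eq0 => /(_ u_neq0).
by rewrite X_eq -scalemxAr -scalemxAl -!mulmxA Tu0 !mulmx0 scaler0 mxE ltxx.
Qed.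

Theorem theorem3p6 (R : realType) (nk : norm_kind) (t : time_domain)
    (n m : nat) (n_gt0 : (0 < n)%N) (m_gt0 : (0 < m)%N)
    (M : model R n m) (M_minimal : minimal M)
    (X : 'M[R[i]]_n) (X_cert : strict_certificates t M X)
    (c : R) (c_gt0 : 0 < c) (c_min : is_lambda_min X (c ^+ 2))
    (T : 'M[R[i]]_n) (X_fact : X = (c ^+ 2)%:C *: (T ^t* *m T)) :
  (passivity_radius nk t (transform T M) ((c ^+ 2)%:C%:M)
     >= passivity_radius nk t M X)%E.
Proof.
have [X_herm X_pos _] := X_cert; have [_ c_le] := c_min.
have T_unit := posdef_factor_unit X_pos X_fact.
have Ti_contr : contraction (invmx T).
  apply: contraction_invmx_factor X_herm T_unit _ _ X_fact.
    by rewrite ltcR exprn_gt0.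
  by move=> _ /complex_realP[mu ->] /c_le; rewrite lecR.
apply/ereal_infP => _ [D /= D_sing <-].
pose S : 'M[R[i]]_(n + m) := pad_mx m (invmx T).
have SK : pad_mx m T *m S = 1%:M.
  by rewrite pad_mxM mulmxV // pad_mx1.
(* S D S^H is the perturbation of M that corresponds to D. *)
apply: (@le_trans _ _ (mxnorm nk (S *m D *m S ^t*))%:E).
  apply: ereal_inf_lbound; exists (S *m D *m S ^t*) => //=.
  apply: (det_W_transform (Y := (c ^+ 2)%:C%:M) T_unit).
    by rewrite X_fact mul_mx_scalar scalemxAl.
  rewrite -perturb_transform.
  rewrite !mulmxA SK mul1mx -mulmxA -adjmxM SK.
  by rewrite trmx1 map_mx1 mulmx1.
rewrite lee_fin; apply: mxnorm_contraction; first by rewrite addn_gt0 n_gt0.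
exact: contraction_pad_mx.
Qed.
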